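(* Let $n$ be an even positive integer, $q$ a power of a prime, and $u,v$ positive integers with $u\le q$ and $v\le q$. Then the family of all subspaces of $(\mathbb{F}_q)^n$ of dimension $n/2$ is the only maximum-sized subset of $\mathcal{L}_n(q)$ that is both $u$-broom free and $v$-fork free. In particular, the maximum size of a $u$-broom and $v$-fork free family in $\mathcal{L}_n(q)$ is ${n \brack n/2}_q$.
   Context: $\mathcal{L}_n(q)$ is the poset of subspaces of $(\mathbb{F}_q)^n$ ordered by inclusion, where $\mathbb{F}_q$ is the field with $q$ elements. ${n \brack k}_q = \frac{[n]_q!}{[k]_q![n-k]_q!}$ with $[m]_q=\frac{q^m-1}{q-1}$ and $[m]_q!=[m]_q\cdots[1]_q$; it is the number of $k$-dimensional subspaces. A $u$-broom is the poset $\{a_0,\dots,a_u\}$ with $a_i<a_0$ for $1\le i\le u$; a $v$-fork is the poset $\{a_0,\dots,a_v\}$ with $a_0<a_i$ for $1\le i\le v$. A poset $P$ contains $Q$ if there is a subset $P_0\subseteq P$ and a bijection $\theta:Q\to P_0$ with $x\le_Q y\Rightarrow\theta(x)\le_P\theta(y)$ (additional relations allowed); $P$ is $Q$-free otherwise. Subsets carry the induced order. *)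

(* Defs.v *)
From HB Require Import structures.
From mathcomp Require Export all_boot all_order all_algebra.

Set Implicit Arguments.
Unset Strict Implicit.
Unset Printing Implicit Defensive.

Import Order.TTheory GRing.Theory Num.Theory.

Fact subspace_display : Order.disp_t. Proof. exact: Order.Disp tt tt. Qed.
Fact broom_display : Order.disp_t. Proof. exact: Order.Disp tt tt. Qed.
Fact fork_display : Order.disp_t. Proof. exact: Order.Disp tt tt. Qed.

(* An alias of {vspace 'rV[F]_n}, which has neither a finite nor an order      *)
(* structure in the library.                                                  *)
Definition subspaces (F : finFieldType) (n : nat) := {vspace 'rV[F]_n}.

Section SubspaceLattice.
Variables (F : finFieldType) (n : nat).
Local Notation L := (subspaces F n).

HB.instance Definition _ := Choice.copy L {vspace 'rV[F]_n}.

Let encodeK : @cancel _ L _ _ := @VectorInternalTheory.vs2mxK F 'rV[F]_n.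
HB.instance Definition _ : isCountable L := CanIsCountable encodeK.
HB.instance Definition _ : isFinite L := CanIsFinite encodeK.

Definition le_subspace : rel L := fun U V => (U <= V)%VS.

Fact le_subspace_refl : reflexive le_subspace.
Proof. by move=> U; apply: subvv. Qed.
Fact le_subspace_anti : antisymmetric le_subspace.
Proof. exact: subv_anti. Qed.
Fact le_subspace_trans : transitive le_subspace.
Proof. by move=> V U W; apply: subv_trans. Qed.

HB.instance Definition _ := Order.Le_isPOrder.Build subspace_display L
  le_subspace_refl le_subspace_anti le_subspace_trans.

Definition level (d : nat) : {set L} :=
  [set U : L | \dim (U : {vspace 'rV[F]_n}) == d].
End SubspaceLattice.

(* In broom and fork, the element a_i is the ordinal i; a_0 is ord0.          *)
Definition broom (u : nat) := 'I_u.+1.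

Section Broom.
Variable u : nat.

HB.instance Definition _ := Finite.copy (broom u) 'I_u.+1.

Definition le_broom : rel (broom u) := fun i j => (i == j) || (j == ord0).

Fact le_broom_refl : reflexive le_broom.
Proof. by move=> i; rewrite /le_broom eqxx. Qed.
Fact le_broom_anti : antisymmetric le_broom.
Proof.
by move=> i j /andP[/orP[/eqP//|/eqP->] /orP[/eqP//|/eqP->]].
Qed.
Fact le_broom_trans : transitive le_broom.
Proof.
move=> j i k /orP[/eqP-> //|/eqP->] /orP[/eqP<-|/eqP->];
  by rewrite /le_broom eqxx orbT.
Qed.

HB.instance Definition _ := Order.Le_isPOrder.Build broom_display (broom u)
  le_broom_refl le_broom_anti le_broom_trans.
End Broom.

Definition fork (v : nat) := 'I_v.+1.

Section Fork.
Variable v : nat.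

HB.instance Definition _ := Finite.copy (fork v) 'I_v.+1.

Definition le_fork : rel (fork v) := fun i j => (i == j) || (i == ord0).

Fact le_fork_refl : reflexive le_fork.
Proof. by move=> i; rewrite /le_fork eqxx. Qed.
Fact le_fork_anti : antisymmetric le_fork.
Proof.
by move=> i j /andP[/orP[/eqP//|/eqP->] /orP[/eqP//|/eqP->]].
Qed.
Fact le_fork_trans : transitive le_fork.
Proof.
move=> j i k /orP[/eqP-> //|/eqP->] _.
by rewrite /le_fork eqxx orbT.
Qed.

HB.instance Definition _ := Order.Le_isPOrder.Build fork_display (fork v)
  le_fork_refl le_fork_anti le_fork_trans.
End Fork.

(* Containment is weak: theta preserves the order but need not reflect it.     *)
(* The family S carries the order induced from T.                             *)
Definition contains (dT dQ : Order.disp_t) (T : finPOrderType dT)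
    (S : {set T}) (Q : finPOrderType dQ) : Prop :=
  exists (S0 : {set T}) (theta : Q -> T),
    [/\ S0 \subset S, injective theta, theta @: [set: Q] = S0
      & {homo theta : x y / (x <= y)%O}].

Definition poset_free (dT dQ : Order.disp_t) (T : finPOrderType dT)
    (Q : finPOrderType dQ) (S : {set T}) : Prop := ~ contains S Q.

Definition broom_fork_free (dT : Order.disp_t) (T : finPOrderType dT)
    (u v : nat) (S : {set T}) : Prop :=
  poset_free (broom u) S /\ poset_free (fork v) S.

Definition max_sized (T : finType) (P : {set T} -> Prop) (S : {set T}) : Prop :=
  P S /\ forall S' : {set T}, P S' -> #|S'| <= #|S|.

Local Open Scope ring_scope.

(* Stated over the rationals so that the divisions are exact.                 *)
Definition qint (q m : nat) : rat := (q%:R ^+ m - 1) / (q%:R - 1).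
Definition qfact (q m : nat) : rat := \prod_(1 <= i < m.+1) qint q i.
Definition qbinom (q n k : nat) : rat :=
  qfact q n / (qfact q k * qfact q (n - k)).

(* Main.v *)
(* Fractional compression. Put m = n/2 and start from the indicator weight w   *)
(* of the family: every point of nonzero weight has weight at most q - 1       *)
(* strictly below it, and at most q - 1 strictly above it. From the top level  *)
(* d + 1 > m, move the weight of each U to its hyperplanes V, in proportion    *)
(* to the room 1 - w V left there. U has [d+1] hyperplanes, of total weight    *)
(* at most q - 1, and V has [n-d] upper covers; as [n-d] + q - 1 < [d+1],      *)
(* a V that was not full does not become full. Both bounds survive: weight     *)
(* only moves down, and below V there is no more weight than below its donors. *)
(* Doing this from the top and, dually, from the bottom, gathers all the       *)
(* weight on level m, where it is at most 1 per point; if anything has moved,  *)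
(* some point of level m is not full, so the inequality is strict.             *)
Require Import Defs.
From mathcomp Require Import ring zify.
From mathcomp Require finfield.

Set Implicit Arguments.
Unset Strict Implicit.
Unset Printing Implicit Defensive.

Import Order.TTheory GRing.Theory Num.Theory.

(** With [u, v <= q], freeness enters only through the bound [q - 1] on the part of the family
    strictly below, or strictly above, each of its members ([admissible_indicator]). For [d >= n/2],
    [d+1] = q^d + [d] exceeds [n-d] + q - 1 ([expansion]); this single inequality keeps every
    receiving point at weight at most 1 ([received_lt]), so the weight can be pushed down to the
    middle ([pushing_down]), and in the dual order up to it. The total weight is preserved, hence
    the bound on the size of the family. Any genuine move leaves a middle point of weight strictly
    between 0 and 1 ([pushed_fractional]). Equality would make all middle points full, so nothing
    moved and the family was the middle level ([card_middle_leqif]). Its size is found by double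
    counting ([card_grassmannian]). *)

(** * Fractional compression in a ranked order *)

Section Push.
Variables (T : finType) (lt : rel T) (r : T -> nat) (k : rat).
Local Open Scope ring_scope.
Hypothesis lt_trans : transitive lt.
Hypothesis lt_rank : forall x y, lt x y -> (r x < r y)%N.
Hypothesis k_ge0 : 0 <= k.

Definition admissible (w : T -> rat) :=
  (forall x, 0 <= w x <= 1) /\
  (forall x, w x != 0 ->
     \sum_(y | lt y x) w y <= k /\ \sum_(y | lt x y) w y <= k).

Section Step.
Variables (d : nat) (a b : rat) (w : T -> rat).
Hypothesis down_degree :
  forall x, r x = d.+1 -> a <= #|[set y | (r y == d) && lt y x]|%:R.
Hypothesis up_degree :
  forall y, r y = d -> #|[set x | (r x == d.+1) && lt y x]|%:R <= b.
Hypothesis b_ge0 : 0 <= b.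
Hypothesis expand : b + k < a.
Hypothesis adm_w : admissible w.
Hypothesis supp_w : forall x, (d.+1 < r x)%N -> w x = 0.

Let room x := \sum_(y | (r y == d) && lt y x) (1 - w y).

Definition transfer x y :=
  if [&& r x == d.+1, r y == d & lt y x] then w x / room x * (1 - w y) else 0.

Definition pushed y := (if r y == d.+1 then 0 else w y) + \sum_x transfer x y.

Let w_ge0 x : 0 <= w x. Proof. by case/andP: (adm_w.1 x). Qed.
Let w_le1 x : w x <= 1. Proof. by case/andP: (adm_w.1 x). Qed.

(** Each of the at least [a] lower covers of [x] offers room 1, less its own weight, and these
    weights total at most [k]. Hence the divisor in [transfer] is positive whenever there is weight
    to move. *)
Lemma roomP x : r x = d.+1 -> w x != 0 -> a - k <= room x.
Proof.
move=> rx /(adm_w.2 x)[below _]; rewrite /room sumrB sumr_const.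
have := down_degree rx; rewrite cardsE => ha.
have: \sum_(y | (r y == d) && lt y x) w y <= \sum_(y | lt y x) w y.
  rewrite [leRHS](bigID (fun y => r y == d)) /=.
  by rewrite (eq_bigl _ _ (fun y => andbC _ _)) lerDl sumr_ge0.
by move=> h; apply: lerB => //; apply: le_trans h below.
Qed.

Lemma room_ge0 x : 0 <= room x.
Proof. by apply: sumr_ge0 => y _; rewrite subr_ge0. Qed.

Lemma transfer_ge0 x y : 0 <= transfer x y.
Proof.
rewrite /transfer; case: ifP => // _.
by rewrite !mulr_ge0 ?invr_ge0 ?room_ge0 ?subr_ge0.
Qed.

Lemma transfer_neq0 x y : transfer x y != 0 ->
  [/\ r x = d.+1, r y = d, lt y x & w x != 0].
Proof.
rewrite /transfer; case: ifP => [/and3P[/eqP-> /eqP-> ->]|]; rewrite ?eqxx //.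
by move=> tn0; split=> //; apply: contraNneq tn0 => ->; rewrite !mul0r.
Qed.

Lemma sum_transfer x : \sum_y transfer x y = if r x == d.+1 then w x else 0.
Proof.
rewrite /transfer; case: eqP => [rx|_] /=; last by rewrite big1.
rewrite -big_mkcond /= -mulr_sumr -/(room x).
have [->|wx] := eqVneq (w x) 0; first by rewrite !mul0r.
rewrite divfK //; apply: lt0r_neq0; apply: lt_le_trans (roomP rx wx).
by rewrite subr_gt0; apply: le_lt_trans expand; rewrite lerDr.
Qed.

(** Each donor has weight at most 1 and room at least [a - k], so it gives [y] at most the fraction
    [1 / (a - k)] of the gap [1 - w y]. There are at most [b < a - k] donors. *)
Lemma received_lt y : r y = d -> w y != 1 ->
  \sum_x transfer x y < 1 - w y.
Proof.
move=> ry wy.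
have ak : 0 < a - k.
  by rewrite subr_gt0; apply: le_lt_trans expand; rewrite lerDr.
have gap : 0 < 1 - w y by rewrite subr_gt0 lt_neqAle wy w_le1.
apply: (@le_lt_trans _ _ (b / (a - k) * (1 - w y))); last first.
  by rewrite gtr_pMl // ltr_pdivrMr // mul1r ltrBrDr.
rewrite /transfer -big_mkcond /= -mulr_suml ler_pM2r //.
apply: (@le_trans _ _ (\sum_(x | (r x == d.+1) && lt y x) (a - k)^-1)).
  rewrite [leLHS](eq_bigl (fun x => (r x == d.+1) && lt y x)); last first.
    by move=> x; rewrite ry eqxx.
  apply: ler_sum => x /andP[/eqP rx _].
  have [->|wx] := eqVneq (w x) 0; first by rewrite mul0r invr_ge0 ltW.
  have rk := roomP rx wx.
  rewrite -[leRHS]mul1r; apply: ler_pM; rewrite ?invr_ge0 ?room_ge0 //.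
  by rewrite lef_pV2 // posrE; apply: lt_le_trans rk.
rewrite sumr_const -mulr_natl; apply: ler_wpM2r; first by rewrite invr_ge0 ltW.
by have := up_degree ry; rewrite cardsE.
Qed.

Lemma pushed_rank_lt y : (r y < d)%N -> pushed y = w y.
Proof.
move=> ryd; rewrite /pushed ltn_eqF 1?ltnW // big1 ?addr0 // => x _.
by apply/eqP/negPn/negP => /transfer_neq0[_ ry]; rewrite ry ltnn in ryd.
Qed.

Lemma pushed_rank_gt y : (d < r y)%N -> pushed y = 0.
Proof.
move=> ryd; rewrite /pushed big1 ?addr0 => [|x _].
  case: eqP => // /eqP ry; apply: supp_w.
  by rewrite ltn_neqAle eq_sym ry.
by apply/eqP/negPn/negP => /transfer_neq0[_ ry]; rewrite ry ltnn in ryd.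
Qed.

Lemma pushed_rank_eq y : r y = d -> pushed y = w y + \sum_x transfer x y.
Proof. by move=> ry; rewrite /pushed ry ltn_eqF. Qed.

Lemma pushed_bound y : 0 <= pushed y <= 1.
Proof.
have [ry|ry|ry] := ltngtP (r y) d.
- by rewrite pushed_rank_lt // w_ge0 w_le1.
- by rewrite pushed_rank_gt // lexx ler01.
rewrite pushed_rank_eq // addr_ge0 ?sumr_ge0 //=; last first.
  by move=> x _; apply: transfer_ge0.
have [wy|wy] := eqVneq (w y) 1; last by rewrite -lerBrDl ltW ?received_lt.
rewrite big1 ?addr0 // => x _.
by rewrite /transfer wy subrr mulr0 if_same.
Qed.

(* The weight only moves downwards, so an up-closed set can only lose weight. *)
Lemma pushed_upset (P : pred T) :
    (forall x y, lt x y -> P x -> P y) ->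
  \sum_(y | P y) pushed y <= \sum_(y | P y) w y.
Proof.
move=> upP; rewrite /pushed big_split /= exchange_big /=.
have le_tr : \sum_x \sum_(y | P y) transfer x y <=
             \sum_(x | P x) (if r x == d.+1 then w x else 0).
  rewrite [leRHS]big_mkcond; apply: ler_sum => x _.
  case: ifPn => [Px|nPx].
    rewrite -sum_transfer [leRHS](bigID P) /= lerDl sumr_ge0 // => y _.
    exact: transfer_ge0.
  rewrite big1 // => y Py; apply/eqP/negPn/negP => /transfer_neq0[_ _ ltyx _].
  by rewrite (upP _ _ ltyx Py) in nPx.
apply: le_trans (lerD (lexx _) le_tr) _.
rewrite -big_split /=; apply: ler_sum => x _.
by case: ifP; rewrite ?add0r ?addr0.
Qed.

Lemma sum_pushed : \sum_y pushed y = \sum_y w y.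
Proof.
rewrite /pushed big_split /= exchange_big /= -big_split /=.
apply: eq_bigr => x _; rewrite sum_transfer.
by case: ifP; rewrite ?add0r ?addr0.
Qed.

Lemma admissible_pushed : admissible pushed.
Proof.
split=> [|z]; first exact: pushed_bound.
(* Everything strictly below such a [z] has rank less than [d], where no weight changes. *)
have below : (r z <= d)%N -> \sum_(y | lt y z) pushed y = \sum_(y | lt y z) w y.
  move=> rz; apply: eq_bigr => y /lt_rank ltyz.
  by rewrite pushed_rank_lt // (leq_trans ltyz).
have [rz|rz|rz] := ltngtP (r z) d.
- rewrite pushed_rank_lt // => /(adm_w.2 z)[dn up]; rewrite below 1?ltnW //.
  split=> //; apply: le_trans up; apply: pushed_upset => x y ltxy ltzx.
  exact: lt_trans ltzx ltxy.
- by rewrite pushed_rank_gt ?eqxx.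
move=> wz; rewrite below ?rz //; split; last first.
  rewrite big1 // => y /lt_rank; rewrite rz; exact: pushed_rank_gt.
have [w0|wz0] := eqVneq (w z) 0; last by case: (adm_w.2 z wz0).
(* A point that was empty and now has weight lies below a donor [x], whose bound it inherits. *)
have [x /transfer_neq0[_ _ ltzx wx]|no] :=
  pickP (fun x => transfer x z != 0); last first.
  case/eqP: wz; rewrite pushed_rank_eq // w0 add0r big1 // => x _.
  by have /negbFE/eqP := no x.
apply: le_trans (adm_w.2 x wx).1; rewrite big_mkcond [leRHS]big_mkcond /=.
apply: ler_sum => y _; case: ifP => [ltyz|_]; last by case: ifP.
by rewrite (lt_trans ltyz ltzx).
Qed.

(** Some lower cover gets a positive share of [w x]. It was not full, since a full point receives
    nothing, and [received_lt] keeps it below 1. *)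
Lemma pushed_fractional x : r x = d.+1 -> w x != 0 ->
  exists2 y, r y = d & 0 < pushed y < 1.
Proof.
move=> rx wx.
have: \sum_y transfer x y != 0 by rewrite sum_transfer rx eqxx.
have [y ty|no] := pickP (fun y => transfer x y != 0); last first.
  by rewrite big1 ?eqxx // => y _; have /negbFE/eqP := no y.
have [_ ry ltyx _] := transfer_neq0 ty.
have wy : w y != 1.
  apply: contraNneq ty => wy.
  by rewrite /transfer wy subrr mulr0 if_same.
exists y; rewrite // pushed_rank_eq //; apply/andP; split.
  rewrite ltr_wpDl // (bigD1 x) //= ltr_pwDl ?sumr_ge0 //.
    by rewrite lt_def ty transfer_ge0.
  by move=> z _; apply: transfer_ge0.
by rewrite addrC -ltrBrDr received_lt.
Qed.
End Step.

(** Levels are emptied from the top, by induction on [e]. Leaving ranks below [m] untouched lets the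
    dual round keep the half already emptied; the final alternative is what uniqueness needs. *)
Lemma pushing_down (m e : nat) (a b : nat -> rat) (w : T -> rat) :
    (forall d x, (m <= d)%N -> r x = d.+1 ->
       a d <= #|[set y | (r y == d) && lt y x]|%:R) ->
    (forall d y, (m <= d)%N -> r y = d ->
       #|[set x | (r x == d.+1) && lt y x]|%:R <= b d) ->
    (forall d, 0 <= b d) ->
    (forall d, (m <= d)%N -> b d + k < a d) ->
    admissible w -> (forall x, (m + e < r x)%N -> w x = 0) ->
  exists w', [/\ admissible w', \sum_y w' y = \sum_y w y,
    forall x, (m < r x)%N -> w' x = 0, forall x, (r x < m)%N -> w' x = w x
    & w' =1 w \/ exists2 y, r y = m & 0 < w' y < 1].
Proof.
move=> ha hb b0 hab; elim: e w => [|e IHe] w adm sup.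
  by exists w; split=> // [x mx|]; [apply: sup; rewrite addn0 | left].
have [x /andP[/eqP rx wx]|no] :=
  pickP (fun x => (r x == (m + e).+1) && (w x != 0)); last first.
  apply: IHe => // x; rewrite leq_eqVlt => /orP[/eqP rx|]; last first.
    by rewrite -addnS; apply: sup.
  by have /negbT := no x; rewrite rx eqxx negbK => /eqP.
have me : (m <= m + e)%N by rewrite leq_addr.
have ha' z := ha _ z me; have hb' z := hb _ z me; have hab' := hab _ me.
have sup' z : ((m + e).+1 < r z)%N -> w z = 0 by rewrite -addnS; apply: sup.
pose w1 := pushed (m + e) w.
have sup1 z : (m + e < r z)%N -> w1 z = 0 by exact: pushed_rank_gt.
have [|w' [adm' sum' top' bot' alt]] := IHe w1 _ sup1.
  exact: (admissible_pushed ha' hb').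
exists w'; split=> //.
- by rewrite sum'; apply: (sum_pushed ha' (b0 _) hab' adm).
- move=> z rz; rewrite bot' // /w1 pushed_rank_lt //.
  exact: leq_trans rz me.
right; case: alt => // ww1.
have [y ry w1y] := pushed_fractional ha' hb' (b0 _) hab' adm rx wx.
(* No later round moved anything, so [y], of rank [m + e], keeps its positive weight; as the result
   vanishes above [m], that rank is [m]. *)
exists y; last by rewrite ww1.
apply/eqP; rewrite ry eqn_leq leq_addr andbT leqNgt; apply/negP => lt_m.
by have := w1y; rewrite -/(w1 y) -ww1 top' ?ltxx ?ry.
Qed.
End Push.

(** * Counting subspaces over a finite field *)

Section Counting.
Variables (F : finFieldType) (n : nat).
Local Notation q := #|F|.
Implicit Types U V W : {vspace 'rV[F]_n}.

Lemma q_gt1 : 1 < q.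
Proof. by apply: card_finNzRing_gt1. Qed.

Lemma card_vdiff W V : (W <= V)%VS ->
  \sum_(x : 'rV[F]_n | (x \in V) && (x \notin W)) 1 = q ^ \dim V - q ^ \dim W.
Proof.
move=> sWV; rewrite sum1_card -!finfield.card_vspace.
rewrite -[#|V|](cardID (mem W)) [X in _ = X + _ - _](_ : _ = #|W|); last first.
  by apply: eq_card => x; rewrite !inE andbC; apply/andb_idr/subvP.
by rewrite addKn; apply: eq_card => x; rewrite !inE andbC.
Qed.

(* A vector x of U outside W lies in a single cover of W, namely W + <x>. *)
Lemma covers_vectors W U : (W <= U)%VS ->
  #|[set V : subspaces F n |
      [&& (W <= V)%VS, (V <= U)%VS
        & \dim (V : {vspace 'rV[F]_n}) == (\dim W).+1]]|
    * (q ^ (\dim W).+1 - q ^ \dim W) = q ^ \dim U - q ^ \dim W.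
Proof.
move=> sWU; rewrite -card_vdiff //.
pose cov (V : subspaces F n) :=
  [&& (W <= V)%VS, (V <= U)%VS & \dim (V : {vspace 'rV[F]_n}) == (\dim W).+1].
have dim_add (x : 'rV[F]_n) : x \notin W -> \dim (W + <[x]>) = (\dim W).+1.
  move=> xW; have x0 : x != 0%R by apply: contraNneq xW => ->; rewrite mem0v.
  rewrite dimv_disjoint_sum ?dim_vline ?x0 ?addn1 //.
  apply/eqP; rewrite -subv0; apply/subvP => y; rewrite memv_cap.
  case/andP=> yW /vlineP[c yc]; rewrite memv0 yc scaler_eq0.
  apply: contraNT xW; rewrite negb_or => /andP[c0 _].
  by rewrite -[x](scalerK c0) -yc rpredZ.
rewrite (partition_big (fun x => (W + <[x]>)%VS : subspaces F n) cov) /=; last first.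
  move=> x /andP[xU xW]; rewrite /cov addvSl dim_add // eqxx andbT.
  by rewrite subv_add sWU -memvE.
rewrite -/cov cardsE -sum_nat_const; apply: eq_bigr => V /and3P[sWV sVU /eqP dV].
rewrite -dV -card_vdiff //; apply: eq_bigl => x; apply/idP/idP.
  case/andP=> xV xW; rewrite (subvP sVU) // xW.
  by rewrite eqEdim subv_add sWV -memvE xV dV dim_add ?leqnn.
case/andP=> /andP[xU xW] /eqP <-; rewrite xW andbT.
by rewrite (subvP (addvSr W _)) ?memv_line.
Qed.

Local Open Scope ring_scope.

Lemma qint_ge0 i : 0 <= qint q i.
Proof.
have q1 := q_gt1.
by rewrite divr_ge0 // subr_ge0 ?exprn_ege1 // ler1n ltnW.
Qed.

Lemma qintS i : qint q i.+1 = q%:R ^+ i + qint q i.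
Proof.
have q1 : (q%:R - 1 : rat) != 0 by rewrite subr_eq0 pnatr_eq1 gtn_eqF ?q_gt1.
by rewrite /qint exprS; field.
Qed.

Lemma qint_gt0 i : (0 < i)%N -> 0 < qint q i.
Proof.
case: i => // i _; rewrite qintS ltr_pwDl ?qint_ge0 //.
by rewrite exprn_gt0 // ltr0n ltnW ?q_gt1.
Qed.

Lemma qint1 : qint q 1 = 1.
Proof. by rewrite qintS /qint expr0 subrr mul0r addr0. Qed.

Lemma qfactS i : qfact q i.+1 = qfact q i * qint q i.+1.
Proof. by rewrite /qfact big_nat_recr. Qed.

Lemma qfact0 : qfact q 0 = 1.
Proof. by rewrite /qfact big_geq. Qed.

Lemma qfact_neq0 i : qfact q i != 0.
Proof.
elim: i => [|i IH]; first by rewrite qfact0 oner_eq0.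
by rewrite qfactS mulf_neq0 // lt0r_neq0 ?qint_gt0.
Qed.

(** This is [covers_vectors] divided by [q ^ \dim W] and [q - 1]. *)
Lemma card_covers W U : (W <= U)%VS ->
  #|[set V : subspaces F n |
      [&& (W <= V)%VS, (V <= U)%VS
        & \dim (V : {vspace 'rV[F]_n}) == (\dim W).+1]]|%:R
  = qint q (\dim U - \dim W).
Proof.
move=> sWU; have := covers_vectors sWU; set c := #|_|.
move=> /(congr1 (fun i => i%:R : rat)).
have q0 : (0 < q)%N by rewrite ltnW ?q_gt1.
have sD := dimvS sWU; rewrite natrM !natrB ?leq_pexp2l // !natrX.
have q1 : (q%:R - 1 : rat) != 0 by rewrite subr_eq0 pnatr_eq1 gtn_eqF ?q_gt1.
have qd : (q%:R ^+ \dim W : rat) != 0 by rewrite expf_neq0 // pnatr_eq0 -lt0n.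
rewrite -{1}(subnK sD) exprD exprS => e; rewrite /qint.
apply: (mulIf q1); rewrite divfK //; apply: (mulIf qd).
rewrite -[c%:R * _ * _]mulrA !mulrBl !mul1r; exact: e.
Qed.

Definition grassmannian U j : {set subspaces F n} :=
  [set V : subspaces F n | (V <= U)%VS & \dim (V : {vspace 'rV[F]_n}) == j].

(* Double counting of the covers V' < V inside U, V of dimension j + 1. *)
Lemma card_grassmannian j U : (j <= \dim U)%N ->
  #|grassmannian U j|%:R = qbinom q (\dim U) j.
Proof.
elim: j U => [|j IHj] U jU.
  rewrite /qbinom qfact0 mul1r subn0 divff ?qfact_neq0 //.
  rewrite [grassmannian U 0](_ : _ = [set (0%VS : subspaces F n)]) ?cards1 //.
  apply/setP=> V; rewrite !inE dimv_eq0; apply: andb_idl => /eqP ->.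
  exact: sub0v.
pose pair (V' V : subspaces F n) :=
  [&& V' \in grassmannian U j, V \in grassmannian U j.+1 & (V' <= V)%VS].
have dbl :
    \sum_V' \sum_V (pair V' V)%:R = \sum_V \sum_V' (pair V' V)%:R :> rat.
  exact: exchange_big.
have count1 : \sum_V' \sum_V (pair V' V)%:R =
              #|grassmannian U j|%:R * qint q (\dim U - j).
  rewrite mulr_natl -sumr_const [RHS]big_mkcond /=; apply: eq_bigr => V' _.
  rewrite /pair; case: ifP => /= [|_]; last by rewrite big1.
  rewrite inE => /andP[sV' /eqP dV'].
  rewrite -dV' -card_covers // -sum1_card natr_sum big_mkcond.
  rewrite [in RHS]big_mkcond /=; apply: eq_bigr => V _.
  rewrite !inE dV' [LHS](congr1 (fun c : bool => c%:R) (andbC _ _)).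
  by case: (_ && _).
have count2 : \sum_V \sum_V' (pair V' V)%:R =
              #|grassmannian U j.+1|%:R * qint q j.+1.
  rewrite mulr_natl -sumr_const [RHS]big_mkcond /=; apply: eq_bigr => V _.
  rewrite /pair; under eq_bigr => V' _ do rewrite andbCA.
  case: ifP => /= [|_]; last by rewrite big1.
  rewrite inE => /andP[sV /eqP dV].
  (* The induction hypothesis is used inside [V] here and inside [U] below, hence the general [U] in
     the induction. A space of dimension [j + 1] has [j+1] hyperplanes. *)
  transitivity (#|grassmannian V j|%:R : rat).
    rewrite -sum1_card natr_sum [in RHS]big_mkcond /=; apply: eq_bigr => V' _.
    rewrite !inE; have [sV'V|] := boolP (V' <= V)%VS; last by rewrite andbF.
    by rewrite (subv_trans sV'V sV) andbT; case: (_ == _).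
  rewrite IHj ?dV // /qbinom subSnn !qfactS qfact0 mul1r qint1 mulr1.
  by rewrite mulrAC divff ?mul1r ?qfact_neq0.
have := dbl; rewrite count1 count2 IHj ?(ltnW jU) // => e.
have qj : qint q j.+1 != 0 by rewrite lt0r_neq0 ?qint_gt0.
apply: (mulIf qj); rewrite -e /qbinom (qfactS j).
have -> : (\dim U - j = (\dim U - j.+1).+1)%N by rewrite subnSK.
rewrite qfactS; have f1 := qfact_neq0 j; have f2 := qfact_neq0 (\dim U - j.+1).
have qD : qint q (\dim U - j.+1).+1 != 0 by rewrite lt0r_neq0 ?qint_gt0.
by field; rewrite f1 f2 qD qj.
Qed.

Lemma dim_rV_full : \dim (fullv : {vspace 'rV[F]_n}) = n.
Proof. by rewrite dimvf /dim /= mul1n. Qed.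

Lemma card_level d : (d <= n)%N -> #|level F n d|%:R = qbinom q n d.
Proof.
move=> dn; have dimT := dim_rV_full.
rewrite -[n in qbinom q n]dimT -card_grassmannian ?dimT //.
by congr (_%:R); apply: eq_card => V; rewrite !inE subvf.
Qed.

Lemma lt_subspaceE (U V : subspaces F n) :
  (U < V)%O =
  (U <= V)%VS && (\dim (U : {vspace 'rV[F]_n}) < \dim (V : {vspace 'rV[F]_n}))%N.
Proof.
rewrite lt_neqAle [(_ <= _)%O]/(U <= V)%VS andbC; apply: andb_id2l => sUV.
rewrite ltnNge; congr (~~ _); rewrite [LHS](eqEdim (U : {vspace _}) V).
by apply: andb_idl => _.
Qed.

Lemma card_upper_covers d (W : subspaces F n) :
    \dim (W : {vspace 'rV[F]_n}) = d ->
  #|[set V : subspaces F n |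
      (\dim (V : {vspace 'rV[F]_n}) == d.+1) && (W < V)%O]|%:R
  = qint q (n - d).
Proof.
move=> dW; have dimT := dim_rV_full.
rewrite -[n in qint q (n - _)]dimT -dW -card_covers ?subvf //.
congr (_%:R); apply: eq_card => V; rewrite !inE subvf lt_subspaceE /=.
by rewrite andbC -andbA; congr (_ && _); apply: andb_idl => /eqP ->.
Qed.

Lemma card_lower_covers d (U : subspaces F n) :
    \dim (U : {vspace 'rV[F]_n}) = d.+1 ->
  #|[set V : subspaces F n |
      (\dim (V : {vspace 'rV[F]_n}) == d) && (V < U)%O]|%:R
  = qint q d.+1.
Proof.
move=> dU; transitivity (#|grassmannian U d|%:R : rat).
  congr (_%:R); apply: eq_card => V; rewrite !inE lt_subspaceE dU /=.
  by rewrite andbC -andbA; congr (_ && _); apply: andb_idl => /eqP ->.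
rewrite card_grassmannian ?dU // /qbinom subSnn !qfactS qfact0 mul1r qint1 mulr1.
by rewrite mulrAC divff ?mul1r ?qfact_neq0.
Qed.
End Counting.

(** * Brooms and forks as bounds on down-sets and up-sets *)

Section Containment.
Variables (dT : Order.disp_t) (T : finPOrderType dT).
Implicit Types S A : {set T}.

(** Ignoring the order lets one map serve both brooms ([A] below [x]) and forks ([A] above [x]). *)
Lemma star_embedding (u : nat) (x : T) A : x \notin A -> (u <= #|A|)%N ->
  exists theta : 'I_u.+1 -> T, [/\ injective theta, theta ord0 = x &
    forall i, i != ord0 -> theta i \in A].
Proof.
move=> xA uA; pose leaf (j : 'I_u) := enum_val (widen_ord uA j).
have leafA j : leaf j \in A by apply: enum_valP.
pose theta (i : 'I_u.+1) := oapp leaf x (unlift ord0 i).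
have theta0 : theta ord0 = x by rewrite /theta unlift_none.
have thetaS j : theta (lift ord0 j) = leaf j by rewrite /theta liftK.
exists theta; split=> // [i j|i].
  case: (unliftP ord0 i) => [i'|] ->; case: (unliftP ord0 j) => [j'|] ->;
    rewrite ?theta0 ?thetaS // => e.
  - by congr lift; apply/val_inj; have /(congr1 val) := enum_val_inj e.
  - by rewrite -e leafA in xA.
  - by rewrite e leafA in xA.
by case: (unliftP ord0 i) => [i'|] ->; rewrite ?eqxx // thetaS.
Qed.

Lemma contains_of_embedding dQ (Q : finPOrderType dQ) S (theta : Q -> T) :
    injective theta -> (forall i, theta i \in S) ->
    {homo theta : x y / (x <= y)%O} ->
  contains S Q.
Proof.
move=> inj inS homo; exists (theta @: [set: Q]), theta; split=> //.
by apply/subsetP => _ /imsetP[i _ ->].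
Qed.

(** Any [u] members below [x] form a broom with it: containment is weak, so relations among them do
    no harm. *)
Lemma broom_free_below u S x : poset_free (broom u) S -> x \in S ->
  (#|[set y in S | (y < x)%O]| < u)%N.
Proof.
move=> free xS; rewrite ltnNge; apply/negP => uA; apply: free.
have [|theta [inj th0 thA]] := @star_embedding u x _ _ uA.
  by rewrite inE ltxx andbF.
have thS i : i != ord0 -> theta i \in S /\ (theta i < x)%O.
  by move/thA; rewrite inE => /andP.
apply: (@contains_of_embedding _ (broom u) _ theta) => // [i|i j].
  by have [->|/thS[]//] := eqVneq i ord0; rewrite th0.
case/orP=> /eqP ->; rewrite // th0.
by have [->|/thS[_ /ltW//]] := eqVneq i ord0; rewrite th0.
Qed.

Lemma fork_free_above v S x : poset_free (fork v) S -> x \in S ->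
  (#|[set y in S | (x < y)%O]| < v)%N.
Proof.
move=> free xS; rewrite ltnNge; apply/negP => vA; apply: free.
have [|theta [inj th0 thA]] := @star_embedding v x _ _ vA.
  by rewrite inE ltxx andbF.
have thS i : i != ord0 -> theta i \in S /\ (x < theta i)%O.
  by move/thA; rewrite inE => /andP.
apply: (@contains_of_embedding _ (fork v) _ theta) => // [i|i j].
  by have [->|/thS[]//] := eqVneq i ord0; rewrite th0.
case/orP=> /eqP ->; rewrite // th0.
by have [->|/thS[_ /ltW//]] := eqVneq j ord0; rewrite th0.
Qed.

(** A comparable pair of [Q] would go to a comparable pair of [S], hence to equal points, against
    injectivity. *)
Lemma antichain_free dQ (Q : finPOrderType dQ) S (i j : Q) :
    {in S &, forall x y, (x <= y)%O -> x = y} -> (i < j)%O ->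
  poset_free Q S.
Proof.
move=> anti ltij [S0 [theta [sS0 inj im homo]]].
have inS l : theta l \in S by apply: (subsetP sS0); rewrite -im imset_f.
have eq_ij := inj _ _ (anti _ _ (inS i) (inS j) (homo _ _ (ltW ltij))).
by rewrite eq_ij ltxx in ltij.
Qed.

Lemma antichain_broom_fork_free u v S : (0 < u)%N -> (0 < v)%N ->
  {in S &, forall x y, (x <= y)%O -> x = y} -> broom_fork_free u v S.
Proof.
case: u v => // u [] // v _ _ anti; split.
  by apply: (@antichain_free _ (broom u.+1) S (lift ord0 ord0) ord0 anti).
by apply: (@antichain_free _ (fork v.+1) S ord0 (lift ord0 ord0) anti).
Qed.
End Containment.

(** * The middle level of the subspace lattice *)

Section Middle.
Variables (F : finFieldType) (n u v : nat).
Local Notation q := #|F|.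
Local Notation L := (subspaces F n).
Local Notation dimL := (fun U : L => \dim (U : {vspace 'rV[F]_n})).
Local Open Scope ring_scope.
Hypotheses (n_gt0 : (0 < n)%N) (n_even : ~~ odd n).
Hypotheses (u_le_q : (u <= q)%N) (v_le_q : (v <= q)%N).

Let m := n./2.
Let m_double : (m + m = n)%N.
Proof. by rewrite addnn halfK (negbTE n_even) subn0. Qed.
Let m_gt0 : (0 < m)%N.
Proof. by move: n_gt0; rewrite -m_double; case: m. Qed.

Lemma dim_le_n (U : L) : (dimL U <= n)%N.
Proof. by rewrite -[leqRHS](dim_rV_full F) dimvS ?subvf. Qed.

(** From [n - d <= d] follows [n-d] <= [d], and [q - 1 < q <= q ^ d] because [d >= m >= 1]. *)
Lemma expansion d : (m <= d)%N -> qint q (n - d) + (q%:R - 1) < qint q d.+1.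
Proof.
move=> md; have q1 := q_gt1 F.
have mono i j : (i <= j)%N -> qint q i <= qint q j.
  move=> /subnK <-; elim: (j - i)%N => [|l IH]; first by rewrite add0n.
  by apply: le_trans IH _; rewrite addSn qintS lerDr exprn_ge0.
rewrite qintS addrC ltr_leD //; last by apply: mono; lia.
rewrite ltrBlDr (@le_lt_trans _ _ (q%:R ^+ d)) ?ltrDl //.
by rewrite -[leLHS]expr1 ler_weXn2l ?ler1n ?(ltnW q1) // (leq_trans m_gt0).
Qed.

Lemma admissible_indicator (S : {set L}) : broom_fork_free u v S ->
  admissible (fun U V : L => (U < V)%O) (q%:R - 1) (fun U => (U \in S)%:R).
Proof.
move=> [bf ff]; split=> [U|U]; first by case: (U \in S).
have q1 := q_gt1 F; have -> : q%:R - 1 = q.-1%:R :> rat.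
  by rewrite -subn1 natrB // ltnW.
have count (P : pred L) :
    \sum_(V | P V) (V \in S)%:R = #|[set V in S | P V]|%:R :> rat.
  rewrite -sum1_card natr_sum big_mkcond [RHS]big_mkcond; apply: eq_bigr => V _.
  by rewrite inE; case: (P V); case: (V \in S).
have [US _|] := boolP (U \in S); last by rewrite eqxx.
have predq i : (i < q)%N -> (i <= q.-1)%N by lia.
rewrite !count !ler_nat; split; apply: predq.
  exact: leq_trans (broom_free_below bf US) _.
exact: leq_trans (fork_free_above ff US) _.
Qed.

Lemma dim_codim (U : L) d : (n - dimL U = d)%N -> dimL U = (n - d)%N.
Proof. by move=> <-; rewrite subKn ?dim_le_n. Qed.

(** The form [leqif] draws the bound and its equality case from the same two rounds of pushing. *)
Lemma card_middle_leqif (S : {set L}) : broom_fork_free u v S ->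
  (#|S| <= #|level F n m| ?= iff (S == level F n m))%N.
Proof.
move=> free; have adm := admissible_indicator free.
pose w (U : L) : rat := (U \in S)%:R.
have k0 : (0 : rat) <= q%:R - 1 by rewrite subr_ge0 ler1n ltnW ?q_gt1.
have b0 d : 0 <= qint q (n - d) by apply: qint_ge0.
have [||||w1 [adm1 sum1 top1 bot1 alt1]] :=
  @pushing_down L (fun U V => (U < V)%O) dimL _ lt_trans _ k0 m n
    (fun d => qint q d.+1) (fun d => qint q (n - d)) w _ _ b0 expansion adm _.
- by move=> U V; rewrite lt_subspaceE => /andP[].
- by move=> d U _ dU; rewrite card_lower_covers.
- by move=> d U _ dU; rewrite card_upper_covers.
- by move=> U; rewrite ltnNge (leq_trans (dim_le_n U)) ?leq_addl.
have adm1' : admissible (fun U V : L => (V < U)%O) (q%:R - 1) w1.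
  by split=> [|U /(adm1.2 U)[]]; [exact: adm1.1|].
(* Dual round: reversed order, codimension as rank. Since [n - m = m], the same [m], degrees and
   [expansion] apply. *)
have [|||||w2 [adm2 sum2 top2 bot2 alt2]] :=
  @pushing_down L (fun U V => (V < U)%O) (fun U => n - dimL U)%N _ _ _ k0 m n
    (fun d => qint q d.+1) (fun d => qint q (n - d)) w1 _ _ b0 expansion adm1' _.
- by move=> V U W ltVU ltWV; apply: lt_trans ltWV ltVU.
- move=> U V; rewrite lt_subspaceE => /andP[_ ltVU].
  by have := dim_le_n U; have := dim_le_n V; lia.
- move=> d U _ rU; have dU := dim_codim rU.
  rewrite [X in _ <= X%:R](_ : _ =
    #|[set V : L | (dimL V == (n - d.+1).+1) && (U < V)%O]|).
    by rewrite card_upper_covers // subKn // -rU leq_subr.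
  apply: eq_card => V; rewrite !inE; congr (_ && _).
  by have := dim_le_n V; lia.
- move=> d U _ rU; have dU := dim_codim rU.
  (* [card_lower_covers] needs a positive dimension; the zero space has no lower covers. *)
  case E: (n - d)%N dU => [|d'] dU.
    rewrite (_ : [set _ | _] = set0) ?cards0 ?qint_ge0 //.
    by apply/setP=> V; rewrite !inE lt_subspaceE /= dU ltn0 !andbF.
  rewrite [X in X%:R <= _](_ : _ = #|[set V : L | (dimL V == d') && (V < U)%O]|).
    by rewrite card_lower_covers.
  apply: eq_card => V; rewrite !inE; congr (_ && _).
  by have := dim_le_n V; lia.
- by move=> U; rewrite ltnNge (leq_trans (leq_subr _ _)) ?leq_addl.
(* Below the middle the second round removed all weight; above it the first did, and the second
   changed nothing there. *)
have supp2 U : dimL U != m -> w2 U = 0.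
  rewrite neq_ltn => /orP[lt|gt].
    by apply: top2; lia.
  by rewrite bot2 ?top1 //; have := dim_le_n U; lia.
have w2_le1 U : w2 U <= 1 by case/andP: (adm2.1 U).
have sumS : #|S|%:R = \sum_(U in level F n m) w2 U.
  transitivity (\sum_U w U).
    rewrite -sum1_card natr_sum big_mkcond; apply: eq_bigr => U _.
    by rewrite /w; case: (U \in S).
  rewrite -sum1 -sum2 [RHS]big_mkcond; apply: eq_bigr => U _.
  by rewrite inE; case: eqP => // /eqP /supp2.
have bound : #|S|%:R <= #|level F n m|%:R :> rat.
  by rewrite sumS -sum1_card natr_sum ler_sum.
split; first by rewrite -(ler_nat rat).
apply/eqP/eqP => [cardS|->] //.
(* The middle weights are at most 1 and add up to the size of the level, so none can be smaller. *)
have full U : dimL U = m -> w2 U = 1.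
  move=> dU; apply/eqP; rewrite eq_le w2_le1 /= leNgt; apply/negP => lt1.
  suff: #|S|%:R < #|level F n m|%:R :> rat by rewrite cardS ltxx.
  have lU : U \in level F n m by rewrite inE dU.
  rewrite sumS -sum1_card natr_sum (bigD1 U) //= [ltRHS](bigD1 U) //=.
  by rewrite ltr_leD // ler_sum.
(* A move in either round would leave a fractional middle point, which [full] excludes; so the
   indicator of [S] is already the final weight. *)
have w2w1 : w2 =1 w1.
  case: alt2 => // -[U rU /andP[_]]; rewrite full ?ltxx //.
  by rewrite (dim_codim rU); lia.
have w1w : w1 =1 w.
  case: alt1 => // -[U rU /andP[_]].
  by rewrite -w2w1 full ?ltxx.
apply/setP => U; rewrite inE.
have := w1w U; rewrite -w2w1 /w.
have [dU|/supp2 ->] := eqVneq (dimL U) m.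
  by rewrite full //; case: (U \in S).
by case: (U \in S).
Qed.
End Middle.

Theorem theoremB (p k q : nat) (F : finFieldType) (n u v : nat)
    (prime_p : prime p) (k_gt0 : 0 < k) (def_q : q = p ^ k)
    (card_F : #|F| = q)
    (n_gt0 : 0 < n) (n_even : ~~ odd n)
    (u_gt0 : 0 < u) (v_gt0 : 0 < v) (u_le_q : u <= q) (v_le_q : v <= q) :
  (forall S : {set subspaces F n},
     max_sized (@broom_fork_free _ (subspaces F n) u v) S
       <-> S = level F n n./2)
  /\ (exists S : {set subspaces F n},
        max_sized (@broom_fork_free _ (subspaces F n) u v) S
        /\ (#|S|%:R = qbinom q n n./2 :> rat)%R).
Proof.
rewrite -card_F in u_le_q v_le_q *.
have bound := card_middle_leqif n_gt0 n_even u_le_q v_le_q.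
have free : broom_fork_free u v (level F n n./2).
  apply: antichain_broom_fork_free => // U V; rewrite !inE => /eqP dU /eqP dV sUV.
  by apply/eqP; rewrite eqEdim dU dV leqnn andbT; apply: sUV.
have max_level : max_sized (@broom_fork_free _ (subspaces F n) u v) (level F n n./2).
  by split=> // S /bound[].
split=> [S|].
  split=> [[freeS maxS]|->] //; have [le_S eq_S] := bound S freeS.
  by apply/eqP; rewrite -eq_S eqn_leq le_S maxS.
exists (level F n n./2); split=> //; apply: card_level.
by rewrite -divn2 leq_div.
Qed.
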